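(* For every positive integer $n$, $c(l_\infty^{n+1},n)=1$. In particular, if a closed topological manifold $M^n$ bounds a domain $\Omega$ in $l_\infty^{n+1}$, then $$\mathrm{HC}_{n+1}(\Omega)\le \mathrm{HC}_n(M^n)^{\frac{n+1}{n}},$$ and if $\Omega$ is a coordinate cube, then this inequality becomes an equality.
   Context: $l_\infty^{n+1}$ is $\mathbb{R}^{n+1}$ with the max-norm. For a real $m>0$ and a subset $V$ of a metric space $Z$, the $m$-dimensional Hausdorff content $\mathrm{HC}_m(V)$ is the infimum of $\sum_i r_i^m$ over all coverings of $V$ by countably many closed metric balls $B(x_i,r_i)$ in $Z$ (here $Z=l_\infty^{n+1}$, so metric balls of radius $r$ are axis-parallel cubes of side length $2r$). For an $(n+1)$-dimensional Banach space $B^{n+1}$, $c(B^{n+1},m)$ denotes the optimal (smallest) constant $c$ such that $\mathrm{HC}_{m+1}(\Omega)\le c\,\mathrm{HC}_m(M^n)^{\frac{m+1}{m}}$ for all open (bounded) domains $\Omega\subset B^{n+1}$ bounded by a closed hypersurface $M^n$ (a compact $n$-dimensional topological manifold without boundary, $\partial\Omega=M^n$). A coordinate cube is a cube with edges parallel to the coordinate axes. *)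

(* Defs.v *)
From mathcomp Require Import all_boot all_order all_algebra.
From mathcomp Require Import all_classical all_reals all_analysis.

Set Implicit Arguments.
Unset Strict Implicit.
Unset Printing Implicit Defensive.

Import Order.TTheory GRing.Theory Num.Theory.
Import numFieldNormedType.Exports.

Local Open Scope classical_set_scope.
Local Open Scope ring_scope.

(* The radii may be 0: such a ball is a point and contributes 0 `^ m = 0 (for
   m > 0), so that finite coverings are covered by sequences as well. *)
Definition HC (R : realType) (B : normedModType R) (m : R) (V : set B) :
    \bar R :=
  ereal_inf [set s : \bar R | exists (x : nat -> B) (r : nat -> R),
    [/\ forall i, 0 <= r i,
        V `<=` \bigcup_i closed_ball_ Num.norm (x i) (r i) &
        s = (\sum_(i <oo) (r i `^ m)%:E)%E]].

Definition boundary (T : topologicalType) (A : set T) : set T :=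
  closure A `\` interior A.

Definition homeomorphic_by (T U : topologicalType) (A : set T) (A' : set U)
    (f : T -> U) (g : U -> T) : Prop :=
  [/\ f @` A `<=` A', g @` A' `<=` A,
      {in A, cancel f g}, {in A', cancel g f} &
      {within A, continuous f} /\ {within A', continuous g}].

(* Compact n-dimensional topological manifold without boundary;
   Hausdorffness and second countability are automatic for compact subsets of
   a normed space. *)
Definition closed_manifold (R : realType) (B : normedModType R) (n : nat)
    (M : set B) : Prop :=
  compact M /\
  forall p, M p -> exists (U : set B) (W : set 'rV[R]_n)
      (f : B -> 'rV[R]_n) (g : 'rV[R]_n -> B),
    [/\ open U, U p, open W & homeomorphic_by (M `&` U) W f g].

Definition domain (T : topologicalType) (Omega : set T) : Prop :=
  [/\ Omega !=set0, open Omega & connected Omega].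

Definition bounds (R : realType) (B : normedModType R) (n : nat)
    (M Omega : set B) : Prop :=
  [/\ closed_manifold n M, domain Omega, bounded_set Omega &
      boundary Omega = M].

(* The optimal constant c(B, m), where B is meant to have dimension n + 1
   (and is then automatically a Banach space). *)
Definition isop_const (R : realType) (B : normedModType R) (n : nat) (m : R) :
    \bar R :=
  ereal_inf [set c%:E | c in [set c : R | forall M Omega : set B,
    bounds n M Omega ->
    (HC (m + 1) Omega <= c%:E * (HC m M) `^ ((m + 1) / m))%E]].

(* Domains being open, the cubes are open cubes, here of side length s. *)
Definition coordinate_cube (R : realType) (d : nat) (Omega : set 'rV[R]_d) :
    Prop :=
  exists (a : 'rV[R]_d) (s : R), 0 < s /\
    Omega = [set x | forall i, a ord0 i < x ord0 i < a ord0 i + s].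

(* Main.v *)
Require Import Defs.
From mathcomp Require Import all_boot all_order all_algebra.
From mathcomp Require Import all_classical all_reals all_analysis.
From mathcomp Require Import ring lra.
Set Implicit Arguments.
Unset Strict Implicit.
Unset Printing Implicit Defensive.

Import Order.TTheory GRing.Theory Num.Theory.
Import numFieldNormedType.Exports.
Local Open Scope classical_set_scope.
Local Open Scope ring_scope.

(** In the max-norm a ball of radius r is a cube of volume (2r)^(n+1), so
    HC_(n+1) of an open set is its volume up to the factor 2^(n+1), and the
    inequality is an isoperimetric inequality in which the size of the boundary
    is measured through its coordinate projections. A line parallel to the j-th
    axis through a point of a bounded open set Omega must leave Omega, hence it
    meets the boundary; so the projection of Omega along that axis lies in the
    projection of the boundary. If the boundary is covered by cubes of radii
    r_i, each projection of Omega has volume at most S = sum_i (2 r_i)^n, and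
    the Loomis-Whitney inequality vol(Omega)^n <= prod_j vol(proj_j Omega) gives
    vol(Omega)^n <= S^(n+1); the powers of 2 cancel.

    Volumes are replaced by counts on a grid whose mesh tends to 0. Cells meeting Omega form a finite set of integer points, to which
    [loomis_whitney] is applied; [HC_le_grid] is the argument above for one
    grid, [HC_isoperimetric_finite] its limit, and [le_HC_compact] passes from
    finite coverings of the compact boundary to countable ones
    ([HC_isoperimetric]).

    For a cube of radius r the boundary is covered by the closed cube itself, so
    HC_n of the boundary is at most r^n, while HC_(n+1) of the cube is r^(n+1)
    ([HC_ball]), again by counting grid points. Hence equality holds for cubes
    ([HC_ball_isoperimetric_eq]). That the optimal constant is not below 1
    follows from the cube of radius 1, once its boundary is known to be a topological
    manifold: near each point, radial projection from the centre onto the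
    hyperplane of a face is a chart ([closed_manifold_sphere]). *)

(** * The Loomis-Whitney inequality for finite sets *)

(** Hoelder's inequality for n+1 functions with equal exponents, in a form free
    of roots. After division by the sums, it is AM-GM applied for each t. *)
Lemma sum_exp_le_prod_sum (R : realType) (T : finType) (n : nat) (x : T -> R)
    (a : T -> 'I_n.+1 -> R) :
  (forall t, 0 <= x t) -> (forall t j, 0 <= a t j) ->
  (forall t, x t ^+ n.+1 <= \prod_j a t j) ->
  (\sum_t x t) ^+ n.+1 <= \prod_j \sum_t a t j.
Proof.
move=> x0 a0 xa; pose S j := \sum_t a t j.
have S0 j : 0 <= S j by apply: sumr_ge0.
rewrite -[leRHS]/(\prod_j S j).
have [/existsP[j /eqP Sj0]|/existsPn Sn0] := boolP [exists j, S j == 0].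
  rewrite (bigD1 j)//= Sj0 mul0r big1 ?expr0n// => t _; apply/eqP.
  have atj : a t j = 0.
    move/eqP: Sj0; rewrite psumr_eq0// => /allP Sj0.
    by apply/eqP/Sj0; rewrite mem_index_enum.
  have := xa t; rewrite (bigD1 j)//= atj mul0r => xt.
  have: x t ^+ n.+1 == 0 by rewrite eq_le xt exprn_ge0.
  by rewrite expf_eq0 => /andP[].
have Sp j : 0 < S j by rewrite lt_def Sn0 S0.
have PS : 0 < \prod_j S j by apply: prodr_gt0.
(* G is the geometric mean of the sums S j, and the claim is sum x <= G. *)
pose G := (\prod_j S j) `^ n.+1%:R^-1.
have G0 : 0 < G by apply: powR_gt0.
have GX : G ^+ n.+1 = \prod_j S j.
  by rewrite -powR_mulrn ?powR_ge0// -powRrM mulVf ?pnatr_eq0// powRr1// ltW.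
have G0' := ltW G0.
rewrite -GX lerXn2r ?nnegrE ?sumr_ge0//.
have xt t : x t / G <= (\sum_j a t j / S j) / n.+1%:R.
  have aS0 j : 0 <= a t j / S j by apply: divr_ge0.
  rewrite -(@ler_pXn2r _ n.+1)// ?nnegrE ?divr_ge0 ?sumr_ge0//.
  rewrite expr_div_n GX.
  apply: le_trans (_ : \prod_j (a t j / S j) <= _).
    by rewrite big_split/= prodfV ler_pM2r ?invr_gt0.
  have [+ _] := @leif_AGM R 'I_n.+1 predT (fun j => a t j / S j) (fun j _ => aS0 j).
  by rewrite card_ord.
rewrite -(mul1r G) -ler_pdivrMr// big_distrl/=.
apply: (le_trans (ler_sum _ (fun t _ => xt t))).
rewrite -big_distrl/= exchange_big/= ler_pdivrMr ?ltr0n// mul1r.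
rewrite (eq_bigr (fun=> 1)) => [|j _].
  by rewrite sumr_const card_ord.
by rewrite -big_distrl/= mulfV// gt_eqF// Sp.
Qed.

(** The constant is absorbed in one of the functions. *)
Lemma scaled_sum_exp_le_prod_sum (R : realType) (T : finType) (n : nat) (c : R)
    (x : T -> R) (a : T -> 'I_n.+1 -> R) :
  0 <= c -> (forall t, 0 <= x t) -> (forall t j, 0 <= a t j) ->
  (forall t, x t ^+ n.+1 <= c * \prod_j a t j) ->
  (\sum_t x t) ^+ n.+1 <= c * \prod_j \sum_t a t j.
Proof.
move=> c0 x0 a0 xa; pose b t j := (if j == ord0 then c else 1) * a t j.
have scal (g : 'I_n.+1 -> R) :
    \prod_j ((if j == ord0 then c else 1) * g j) = c * \prod_j g j.
  rewrite big_split/= (bigD1 ord0)//= big1 ?mulr1// => j.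
  by move/negbTE => ->.
have := @sum_exp_le_prod_sum R T n x b x0.
rewrite /b; under [X in _ -> _ -> _ <= X]eq_bigr do rewrite -big_distrr/=.
rewrite scal; apply=> [t j|t]; last by rewrite scal.
by case: ifP; rewrite mulr_ge0.
Qed.

Definition drop_coord (T : Type) (n : nat) (j : 'I_n.+1) (f : {ffun 'I_n.+1 -> T}) :
  {ffun 'I_n -> T} := [ffun k => f (lift j k)].

Lemma drop_coordE T n (j : 'I_n.+1) (f : {ffun 'I_n.+1 -> T}) k :
  drop_coord j f k = f (lift j k).
Proof. by rewrite ffunE. Qed.

Definition cons_coord (T : Type) (n : nat) (t : T) (f : {ffun 'I_n -> T}) :
  {ffun 'I_n.+1 -> T} := [ffun k => oapp f t (unlift ord0 k)].

Lemma cons_coord0 T n (t : T) (f : {ffun 'I_n -> T}) : cons_coord t f ord0 = t.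
Proof. by rewrite ffunE unlift_none. Qed.

Lemma cons_coordS T n (t : T) (f : {ffun 'I_n -> T}) k :
  cons_coord t f (lift ord0 k) = f k.
Proof. by rewrite ffunE liftK. Qed.

Lemma cons_coord_inj T n (t : T) : injective (@cons_coord T n t).
Proof.
by move=> f g fg; apply/ffunP => k; rewrite -(cons_coordS t) fg cons_coordS.
Qed.

Lemma drop_coord0_cons T n (t : T) (f : {ffun 'I_n -> T}) :
  drop_coord ord0 (cons_coord t f) = f.
Proof. by apply/ffunP => k; rewrite ffunE cons_coordS. Qed.

Lemma cons_drop_coord0 T n (f : {ffun 'I_n.+1 -> T}) :
  cons_coord (f ord0) (drop_coord ord0 f) = f.
Proof.
by apply/ffunP => k; rewrite ffunE; case: unliftP => [i|] ->/=; rewrite ?ffunE.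
Qed.

Lemma drop_coordS_cons T n (t : T) (f : {ffun 'I_n.+1 -> T}) (j : 'I_n.+1) :
  drop_coord (lift ord0 j) (cons_coord t f) = cons_coord t (drop_coord j f).
Proof.
apply/ffunP => k; rewrite drop_coordE; case: (unliftP ord0 k) => [i|] ->.
  rewrite [RHS]cons_coordS drop_coordE.
  have -> : lift (lift ord0 j) (lift ord0 i) = lift ord0 (lift j i).
    by apply/val_inj; rewrite /= /bump /= !add1n ltnS addnS.
  by rewrite cons_coordS.
have -> : lift (lift ord0 j) (@ord0 n) = @ord0 n.+1 by exact/val_inj.
by rewrite !cons_coord0.
Qed.

Lemma card_sum_slices (I T : finType) (h : I -> T) (A : {set I}) :
  #|A| = \sum_t #|[set f in A | h f == t]| :> nat.
Proof.
rewrite -sum1_card (partition_big h predT)//=; apply: eq_bigr => t _.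
by rewrite -sum1_card; apply: eq_bigl => f; rewrite inE.
Qed.

(** Induction on the dimension, by slicing A along the coordinate 0. A slice
    injects in the projection of A along that coordinate, and it satisfies the
    inequality one dimension lower; multiplying both bounds puts the slice in
    the form required by Hoelder's inequality, because the projections of the
    slices along another coordinate are the slices of the projection.
    Non-emptiness matters only for n = 0, where the left-hand side is 1. *)
Lemma loomis_whitney_nonempty (R : realType) (T : finType) (n : nat)
    (A : {set {ffun 'I_n.+1 -> T}}) : (0 < #|A|)%N ->
  #|A|%:R ^+ n <= \prod_j #|drop_coord j @: A|%:R :> R.
Proof.
elim: n => [|n IH] in A *.
  move=> A0; rewrite expr0 big_ord1 ler1n card_gt0.
  by apply: contraTneq A0 => /eqP; rewrite imset_eq0 => /eqP ->; rewrite cards0.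
move=> _; pose B t : {set {ffun 'I_n.+1 -> T}} := cons_coord t @^-1: A.
have slice t : #|[set f in A | f ord0 == t]| = #|B t|.
  rewrite -(card_imset _ (@cons_coord_inj T n.+1 t)); apply: eq_card => f.
  rewrite inE; apply/andP/imsetP => [[fA /eqP ft]|[g]].
    by exists (drop_coord ord0 f); rewrite ?inE -ft cons_drop_coord0.
  by rewrite inE => gA ->; rewrite cons_coord0.
have slice' t j : (#|drop_coord j @: B t| <=
    #|[set f in drop_coord (lift ord0 j) @: A | f ord0 == t]|)%N.
  rewrite -(card_imset _ (@cons_coord_inj T n t)); apply/subset_leq_card.
  apply/fintype.subsetP => _ /imsetP[_ /imsetP[f + ->] ->]; rewrite !inE => fA.
  rewrite cons_coord0 eqxx andbT -drop_coordS_cons.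
  by apply/imsetP; exists (cons_coord t f).
have BP t : (#|B t| <= #|drop_coord ord0 @: A|)%N.
  apply/subset_leq_card/fintype.subsetP => f; rewrite inE => fA.
  by apply/imsetP; exists (cons_coord t f); rewrite ?drop_coord0_cons.
have := @scaled_sum_exp_le_prod_sum R T n #|drop_coord ord0 @: A|%:R
  (fun t => #|B t|%:R) (fun t j => #|drop_coord j @: B t|%:R) (ler0n _ _)
  (fun t => ler0n _ _) (fun t j => ler0n _ _).
have -> : \sum_t #|B t|%:R = #|A|%:R :> R.
  rewrite -natr_sum (card_sum_slices (fun f : {ffun 'I_n.+2 -> T} => f ord0) A).
  by under [in RHS]eq_bigr do rewrite slice.
move=> H; apply: (le_trans (H _)) => [t|].
  rewrite exprS; have [->|B0] := posnP #|B t|.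
    by rewrite mul0r mulr_ge0// prodr_ge0.
  by rewrite ler_pM ?exprn_ge0 ?ler_nat// IH.
rewrite [leRHS]big_ord_recl ler_wpM2l// ler_prod// => j _.
rewrite sumr_ge0//= -natr_sum ler_nat.
rewrite (card_sum_slices (fun f : {ffun 'I_n.+1 -> T} => f ord0)).
by apply: leq_sum => t _.
Qed.

Theorem loomis_whitney (R : realType) (T : finType) (n : nat)
    (A : {set {ffun 'I_n.+1 -> T}}) : (0 < n)%N ->
  #|A|%:R ^+ n <= \prod_j #|drop_coord j @: A|%:R :> R.
Proof.
move=> n0; have [->|] := posnP #|A|; last exact: loomis_whitney_nonempty.
by rewrite expr0n gtn_eqF//= prodr_ge0.
Qed.

(** * Hausdorff content and finite coverings *)

Lemma HC_le_finite (R : realType) (B : normedModType R) (k : nat) (V : set B)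
    (I : finType) (x : I -> B) (r : I -> R) : (0 < k)%N ->
  (forall i, 0 <= r i) ->
  V `<=` \bigcup_i closed_ball_ Num.norm (x i) (r i) ->
  (HC k%:R V <= (\sum_i r i ^+ k)%:E)%E.
Proof.
move=> k0 r0 VB; apply: ereal_inf_lbound.
exists (fun j => oapp x 0 (onth (enum I) j)), (fun j => oapp r 0 (onth (enum I) j)).
split=> [j|v /VB[i _ vi]|].
- by case: onth.
- have /onthP[j ij] : i \in enum I by rewrite mem_enum.
  by exists j => //=; rewrite ij.
- rewrite (nneseries_split 0 (size (enum I))) => [|j _]; last by rewrite lee_fin powR_ge0.
  rewrite add0n [X in (_ + X)%E]eseries0 => [|j Ij _]; last first.
    by rewrite onth_default//= powR0// pnatr_eq0 -lt0n.
  rewrite adde0 -sumEFin -big_enum; case E : (enum I) => [|i0 s].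
    by rewrite !big_nil.
  rewrite -E (big_nth i0) !big_mkord; apply: eq_bigr => j _.
  have := ltn_ord j; rewrite -onthTE; case F : onth => [i|]//= _.
  by rewrite (onth_nth i0 i _ _ F) powR_mulrn.
Qed.

(** Used to enlarge closed balls into open ones at a small cost. *)
Lemma exp_add_le (R : realType) (k : nat) (r e : R) : 0 <= r -> 0 < e ->
  exists2 d, 0 < d & (r + d) ^+ k <= r ^+ k + e.
Proof.
move=> r0 e0.
have : \forall d \near 0^'+, (r + d) ^+ k <= r ^+ k + e.
  have cf : (r + d) ^+ k @[d --> (0:R)^'+] --> (r + 0) ^+ k.
    apply: cvg_at_right_filter.
    apply: (@continuous_comp _ _ _ (fun d : R => r + d) (fun y => y ^+ k)).
      by apply: cvgD; [exact: cvg_cst|exact: cvg_id].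
    exact: exprn_continuous.
  rewrite addr0 in cf; move/cvgrPdist_le : cf => /(_ _ e0); apply: filterS => d.
  by rewrite ler_distlC => /andP[].
move=> hd; near (0 : R)^'+ => d; exists d; first exact: (near (nbhs_right_gt 0) d).
by near: d.
Unshelve. all: by end_near. Qed.

Lemma sum_geometric_half_le (R : realType) (e : R) m : 0 <= e ->
  \sum_(i < m) e / 2 ^+ i.+1 <= e.
Proof.
move=> e0; have -> : \sum_(i < m) e / 2 ^+ i.+1 = e - e / 2 ^+ m.
  elim: m => [|m IH]; first by rewrite big_ord0 expr0 divr1 subrr.
  rewrite big_ord_recr/= IH exprS; field.
  by rewrite expf_neq0.
by rewrite gerBl divr_ge0// exprn_ge0.
Qed.

(** On a compact set the content can be bounded below through finite coverings:
    the i-th ball of a countable covering is enlarged to an open ball at the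
    cost of at most e / 2^(i+1) in the sum, and compactness leaves finitely many
    of them. *)
Lemma le_HC_compact (R : realType) (B : normedModType R) (k : nat) (K : set B)
    (a : R) : compact K ->
  (forall m (x : 'I_m -> B) (r : 'I_m -> R), (forall i, 0 <= r i) ->
    K `<=` \bigcup_i closed_ball_ Num.norm (x i) (r i) ->
    a <= \sum_i r i ^+ k) ->
  (a%:E <= HC k%:R K)%E.
Proof.
move=> cK H; apply/ereal_infP => _ [x [r [r0 KB ->]]].
apply/lee_addgt0Pr => e e0.
have ex i : exists d, 0 < d /\ (r i + d) ^+ k <= r i ^+ k + e / 2 ^+ i.+1.
  have [|d d0 hd] := @exp_add_le R k (r i) (e / 2 ^+ i.+1) (r0 i); last by exists d.
  by rewrite divr_gt0// exprn_gt0.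
have [d hd] := choice ex.
have := cK; rewrite compact_cover.
move=> /(_ nat setT (fun i => ball (x i) (r i + d i)))[i _|v /KB[i _ vi]|D _ KD].
- exact: ball_open.
- exists i => //; rewrite -ball_normE/=; apply: le_lt_trans vi _.
  by rewrite ltrDl; have [] := hd i.
pose m := (\max_(i <- finmap.enum_fset D) i).+1.
apply: (@le_trans _ _ (\sum_(i < m) (r i + d i) ^+ k)%:E).
  rewrite lee_fin; apply: (H m (fun i => x i)) => [i|v /KD[i /= iD vi]].
    by rewrite addr_ge0// ltW//; have [] := hd i.
  have im : (i < m)%N by rewrite ltnS; apply: leq_bigmax_seq.
  by exists (Ordinal im) => //=; move: vi; rewrite -ball_normE => /ltW.
apply: (@le_trans _ _ ((\sum_(0 <= i < m) (r i `^ k%:R)%:E) + e%:E)%E); last first.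
  rewrite leeD2r// nneseries_lim_ge// => i _ _.
  by rewrite lee_fin powR_ge0.
rewrite big_mkord sumEFin -EFinD lee_fin.
apply: le_trans (_ : \sum_(i < m) (r i ^+ k + e / 2 ^+ i.+1) <= _).
  by apply: ler_sum => i _; have [] := hd i.
rewrite big_split/= lerD ?sum_geometric_half_le ?(ltW e0)//.
by apply: ler_sum => i _; rewrite powR_mulrn.
Qed.

(** * Counting grid points in boxes *)

Lemma card_ord_interval (R : realType) (N : nat) (a b : R) : a <= b ->
  #|[set t : 'I_N | a <= t%:R <= b]%SET|%:R <= b - a + 1.
Proof.
move=> ab; set S := [set t : 'I_N | _]%SET.
have [->|[u uS]] := set_0Vmem S; first by rewrite cards0 addr_ge0// subr_ge0.
have [t0 t0S t0min] := arg_minnP (fun t : 'I_N => t : nat) uS.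
have [t1 t1S t1max] := arg_maxnP (fun t : 'I_N => t : nat) uS.
have {}t1max t : t \in S -> (t <= t1)%N by move=> /t1max.
have t01 : (t0 <= t1)%N := t1max _ t0S.
have cS : (#|S| <= (t1 - t0).+1)%N.
  pose shift (t : 'I_N) : 'I_(t1 - t0).+1 := inord (t - t0).
  rewrite -[leqRHS]card_ord -(@card_in_imset _ _ shift S).
    exact: max_card.
  move=> s t sS tS /(congr1 val) /=.
  rewrite !inordK ?ltnS ?leq_sub2r ?t1max// => st.
  by apply/val_inj; rewrite /= -(subnK (t0min _ sS)) st subnK ?t0min.
apply: (@le_trans _ _ (t1 - t0).+1%:R); first by rewrite ler_nat.
rewrite -natr1 natrB// lerD2r lerB//.
  by have : t1 \in S := t1S; rewrite /S inE => /andP[].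
by have : t0 \in S := t0S; rewrite /S inE => /andP[].
Qed.

Lemma card_grid_box (R : realType) (N n : nat) (a b : 'I_n -> R) (L : R) :
  (forall k, a k <= b k) -> (forall k, b k - a k <= L) ->
  #|[set f : {ffun 'I_n -> 'I_N} | [forall k, a k <= (f k)%:R <= b k]]%SET|%:R
    <= (L + 1) ^+ n.
Proof.
move=> ab abL; pose S k := [set t : 'I_N | a k <= t%:R <= b k]%SET.
rewrite (_ : #|_| = \prod_k #|S k|)%N.
  rewrite natr_prod -[X in _ ^+ X]card_ord -prodr_const; apply: ler_prod => k _.
  by rewrite ler0n/= (le_trans (card_ord_interval _ (ab k)))// lerD2r.
transitivity #|family S|.
  apply: eq_card => f; rewrite inE; apply/forallP/familyP => H k; have := H k.
    by rewrite inE.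
  by rewrite inE.
by rewrite card_family foldrE big_map -big_enum.
Qed.

(** The common counting step of both content estimates; L i bounds the side
    lengths of the i-th box, in units of the mesh. *)
Lemma card_le_sum_grid_boxes (R : realType) (N n : nat) (I : finType)
    (A : {set {ffun 'I_n -> 'I_N}}) (a b : I -> 'I_n -> R) (L : I -> R) :
  (forall i k, a i k <= b i k) -> (forall i k, b i k - a i k <= L i) ->
  (forall f, f \in A -> exists i, forall k, a i k <= (f k)%:R <= b i k) ->
  #|A|%:R <= \sum_i (L i + 1) ^+ n.
Proof.
move=> ab abL cA.
pose S i := [set f : {ffun 'I_n -> 'I_N} | [forall k, a i k <= (f k)%:R <= b i k]]%SET.
apply: (@le_trans _ _ (\sum_i #|S i|%:R)); last first.
  by apply: ler_sum => i _; exact: card_grid_box.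
have : A \subset (\bigcup_i S i)%SET.
  apply/fintype.subsetP => f /cA[i fi]; apply/finset.bigcupP; exists i => //.
  by rewrite inE; apply/forallP.
move=> /subset_leq_card AS; rewrite -natr_sum ler_nat (leq_trans AS)//.
elim/big_rec2 : _ => [|i m U _ Um]; first by rewrite cards0.
by rewrite (leq_trans (leq_card_setU _ _))// leq_add2l.
Qed.

(** * Content of cubes from below, and lines leaving a bounded open set *)

Lemma rV_norm_leP (R : realType) (n : nat) (x : 'rV[R]_n) (r : R) : 0 <= r ->
  (`|x| <= r) <-> (forall j, `|x ord0 j| <= r).
Proof.
move=> r0; rewrite [`|x|]/Num.norm/= mx_normrE; split=> [/bigmax_leP[_ H] j|H].
  exact: (H (ord0, j)).
by apply/bigmax_leP; split=> // -[i j] _; rewrite (ord1 i).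
Qed.

Lemma rV_norm_ltP (R : realType) (n : nat) (x : 'rV[R]_n) (r : R) : 0 < r ->
  (`|x| < r) <-> (forall j, `|x ord0 j| < r).
Proof.
move=> r0; rewrite [`|x|]/Num.norm/= mx_normrE; split=> [/bigmax_ltP[_ H] j|H].
  exact: (H (ord0, j)).
by apply/bigmax_ltP; split=> // -[i j] _; rewrite (ord1 i).
Qed.

Lemma cvg_exprn (R : realType) (T : Type) (F : set_system T) (f : T -> R)
    (a : R) (k : nat) : Filter F ->
  f x @[x --> F] --> a -> f x ^+ k @[x --> F] --> a ^+ k.
Proof.
move=> FF fa.
exact: (@continuous_cvg _ _ _ _ _ f (fun y => y ^+ k) a (@exprn_continuous _ _ _)).
Qed.

(** Lets the mesh of the grid tend to 0. *)
Lemma limit_sum_pow_le (R : realType) (m k l : nat) (h c : R) (r : 'I_m -> R) :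
  (forall N, h <= (\sum_i (r i + c / N.+1%:R) ^+ k) ^+ l) ->
  h <= (\sum_i r i ^+ k) ^+ l.
Proof.
move=> H.
have F0 : (\sum_i (r i + c * harmonic N) ^+ k) ^+ l @[N --> \oo]
    --> (\sum_i (r i + c * 0) ^+ k) ^+ l.
  apply: cvg_exprn; apply: (cvg_big add_continuous) => i _; apply: cvg_exprn.
  apply: cvgD; first exact: cvg_cst.
  by apply: cvgMr; exact: cvg_harmonic.
have -> : \sum_i r i ^+ k = \sum_i (r i + c * 0) ^+ k.
  by apply: eq_bigr => i _; rewrite mulr0 addr0.
by apply: (cvgr_to_ge F0); exact: nearW.
Qed.

(** The comparison of volumes for a cube covered by cubes. The grid with N+1
    points per side has (N+1)^d points in the large cube, and at most
    (r_i (N+1) / rho + 1)^d of them in the i-th small one; the claim is the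
    limit of the resulting inequality. *)
Lemma cube_cover_ge (R : realType) (d : nat) (c : 'rV[R]_d) (rho : R)
    (m : nat) (x : 'I_m -> 'rV[R]_d) (r : 'I_m -> R) : 0 < rho ->
  (forall i, 0 <= r i) ->
  closed_ball_ Num.norm c rho `<=` \bigcup_i closed_ball_ Num.norm (x i) (r i) ->
  rho ^+ d <= \sum_i r i ^+ d.
Proof.
move=> rho0 r0 cov; rewrite -[leRHS]expr1.
apply: (@limit_sum_pow_le _ _ d 1 _ rho) => N; rewrite expr1.
pose e := rho / N.+1%:R.
have e0 : 0 < e by rewrite divr_gt0.
(* The grid has mesh 2e and starts at the lowest corner of the cube; a and b
   are the bounds of the i-th ball in these grid coordinates. *)
pose a i k := (x i ord0 k - r i - c ord0 k + rho) / (2 * e).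
pose b i k := (x i ord0 k + r i - c ord0 k + rho) / (2 * e).
have e20 : 0 < 2 * e by rewrite mulr_gt0.
have := @card_le_sum_grid_boxes R N.+1 d 'I_m finset.setT a b (fun i => r i / e).
have -> : #|[set: {ffun 'I_d -> 'I_N.+1}]%SET| = (N.+1 ^ d)%N.
  by rewrite cardsT card_ffun !card_ord.
move=> H; have {H} : (N.+1 ^ d)%:R <= \sum_i (r i / e + 1) ^+ d.
  apply: H => [i k|i k|f _].
  - by rewrite ler_pM2r ?invr_gt0//; have := r0 i; lra.
  - by rewrite le_eqVlt /a /b; apply/orP; left; apply/eqP; field; rewrite gt_eqF.
  - have [|i _ /= xif] := cov (\row_k (c ord0 k - rho + 2 * e * (f k)%:R)).
      rewrite /closed_ball_/=; apply/rV_norm_leP; first exact: ltW.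
      move=> j; rewrite !mxE.
      have f0 : 0 <= (f j)%:R :> R by [].
      have fN : (f j)%:R <= N.+1%:R :> R by rewrite ler_nat ltnW.
      have eN : e * N.+1%:R = rho by rewrite divfK.
      have : e * (f j)%:R <= rho by rewrite -eN ler_pM2l.
      have : 0 <= e * (f j)%:R by rewrite mulr_ge0// ltW.
      by move=> h1 h2; rewrite ler_norml; lra.
    exists i => k; move/rV_norm_leP : xif => /(_ (r0 i) k); rewrite !mxE.
    rewrite ler_norml /a /b ler_pdivrMr// ler_pdivlMr//; lra.
have ed : 0 <= e ^+ d by rewrite exprn_ge0// ltW.
move=> /(ler_wpM2r ed); rewrite natrX -exprMn mulrC divfK// => /le_trans; apply.
rewrite big_distrl/=; apply: ler_sum => i _; rewrite -exprMn mulrDl mul1r.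
by rewrite divfK// gt_eqF.
Qed.

(** The supremum of the parameters t for which the line is in O: there the line
    is in the closure of O, and it is not in O since O is open. *)
Lemma exit_boundary (R : realType) (B : normedModType R) (O : set B) (x v : B) :
  open O -> bounded_set O -> O x -> v != 0 ->
  exists t : R, boundary O (x + t *: v).
Proof.
move=> oO bO Ox v0; pose l (t : R) := x + t *: v; pose S := l @^-1` O.
have v_gt0 : 0 < `|v| by rewrite normr_gt0.
have cl : continuous l.
  by move=> t; apply: cvgD; [exact: cvg_cst|apply: cvgZl; exact: cvg_id].
have S0 : S 0 by rewrite /S /l /= scale0r addr0.
have ubS : has_ubound S.
  have [M [_ /(_ (M + 1)) OM]] := bO.
  exists ((M + 1 + `|x|) / `|v|) => t St; rewrite ler_pdivlMr//.
  apply: (le_trans (ler_wpM2r (ltW v_gt0) (ler_norm t))); rewrite -normrZ.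
  rewrite -[X in `|X|](addKr x) addrC (le_trans (ler_normD _ _))// normrN lerD2r.
  by apply: OM => //; rewrite ltrDl.
have oS : open S by apply: open_comp.
exists (sup S); split.
  move=> U /cl nU.
  have [t [St Ut]] := @closure_sup R S (ex_intro _ _ S0) ubS _ nU.
  by exists (l t).
rewrite (interior_id _).1// => Osup.
have /nbhs_ballP[e /= e0 eS] := open_nbhs_nbhs (conj oS Osup).
have /(sup_upper_bound (conj (ex_intro _ _ S0) ubS)) : S (sup S + e / 2).
  apply: eS; rewrite -ball_normE /= opprD addNKr normrN gtr0_norm ?divr_gt0//.
  by rewrite ltr_pdivrMr// mulr_natr mulr2n ltrDl.
by rewrite gerDl leNgt divr_gt0.
Qed.

(** * The isoperimetric inequality *)

Lemma HC_ge0 (R : realType) (B : normedModType R) (m : R) (V : set B) :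
  (0 <= HC m V)%E.
Proof.
apply/ereal_infP => _ [x [r [_ _ ->]]]; apply: nneseries_ge0 => i _ _.
by rewrite lee_fin powR_ge0.
Qed.

(** The isoperimetric inequality up to the mesh e = 2K / (N+1) of a grid on the
    cube of radius K around the origin. The bound h is the cost of covering
    Omega by the grid cells that meet it. A projected cell that meets Omega
    meets the projection of a ball of the boundary, by [exit_boundary], and the
    i-th ball accounts for at most (2 r_i / e + 2)^n of these. *)
Lemma HC_le_grid (R : realType) (n N : nat) (Omega : set 'rV[R]_n.+1) (K : R)
    (m : nat) (x : 'I_m -> 'rV[R]_n.+1) (r : 'I_m -> R) :
  (0 < n)%N -> 0 < K -> (forall y, Omega y -> `|y| < K) ->
  open Omega -> (forall i, 0 <= r i) ->
  boundary Omega `<=` \bigcup_i closed_ball_ Num.norm (x i) (r i) ->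
  exists2 h : R, (HC n.+1%:R Omega <= h%:E)%E &
    h ^+ n <= (\sum_i (r i + 2 * K / N.+1%:R) ^+ n) ^+ n.+1.
Proof.
move=> n0 K0 OK oO r0 cov; pose e := 2 * K / N.+1%:R.
have e0 : 0 < e by rewrite divr_gt0// mulr_gt0.
have eN : e * N.+1%:R = 2 * K by rewrite divfK.
pose cell (f : {ffun 'I_n.+1 -> 'I_N.+1}) (y : 'rV[R]_n.+1) :=
  forall j, (f j)%:R <= (y ord0 j + K) / e <= (f j)%:R + 1.
pose A : {set {ffun 'I_n.+1 -> 'I_N.+1}} :=
  [set f | `[< exists2 y, Omega y & cell f y >]]%SET.
have AP f : reflect (exists2 y, Omega y & cell f y) (f \in A).
  by rewrite inE; exact: asboolP.
exists (#|A|%:R * (e / 2) ^+ n.+1).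
  pose ctr (f : {f | f \in A}) : 'rV[R]_n.+1 :=
    \row_j (e * ((sval f j)%:R + 1 / 2) - K).
  have -> : #|A|%:R * (e / 2) ^+ n.+1 = \sum_(f : {f | f \in A}) (e / 2) ^+ n.+1.
    by rewrite sumr_const card_sig mulr_natl.
  apply: (@HC_le_finite _ _ _ _ _ ctr) => // [_|y Oy].
    by rewrite divr_ge0// ltW.
  have yK j : 0 <= (y ord0 j + K) / e < N.+1%:R.
    have /(rV_norm_ltP _ K0)/(_ j) := OK _ Oy; rewrite ltr_norml => /andP[y1 y2].
    by rewrite divr_ge0 ?(ltW e0)//= ?ltr_pdivrMr// 1?mulrC ?eN; lra.
  pose f : {ffun 'I_n.+1 -> 'I_N.+1} :=
    [ffun j => inord (Num.truncn ((y ord0 j + K) / e))].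
  have fy : cell f y.
    move=> j; have /andP[y1 y2] := yK j.
    have /andP[t1 t2] := truncn_itv y1.
    rewrite ffunE inordK ?t1 ?natr1 ?ltW//.
    by rewrite -(ltr_nat R) (le_lt_trans t1).
  have fA : f \in A by apply/AP; exists y.
  exists (exist _ f fA) => //=; apply/rV_norm_leP; first by rewrite divr_ge0// ltW.
  move=> j; have := fy j; rewrite ler_pdivrMr// ler_pdivlMr// !mxE ler_norml/=.
  move=> /andP[]; lra.
have proj j : #|drop_coord j @: A|%:R <= \sum_i (2 * r i / e + 1 + 1) ^+ n.
  apply: (@card_le_sum_grid_boxes R _ _ _ _
    (fun i k => (x i ord0 (lift j k) - r i + K) / e - 1)
    (fun i k => (x i ord0 (lift j k) + r i + K) / e))
    => [i k|i k|_ /imsetP[f /AP[y Oy fy] ->]].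
  - rewrite -subr_ge0 (_ : _ - _ = 2 * r i / e + 1); last first.
      by field; rewrite gt_eqF.
    by rewrite addr_ge0// divr_ge0 ?(ltW e0)// mulr_ge0.
  - rewrite le_eqVlt; apply/orP; left; apply/eqP; field; by rewrite gt_eqF.
  have bO : bounded_set Omega.
    exists K; split=> [|M KM z /OK /ltW zK]; first exact: gtr0_real.
    by rewrite /= (le_trans zK)// ltW.
  (* The line through y parallel to the j-th axis meets the boundary at a point
     of the i-th ball, and this point has the other coordinates of y. *)
  have [|t /cov[i _ /= xit]] := @exit_boundary R _ Omega y (delta_mx ord0 j) oO bO Oy.
    apply/eqP => /matrixP/(_ ord0 j); rewrite !mxE !eqxx => /eqP.
    by rewrite oner_eq0.
  exists i => k; move/rV_norm_leP : xit => /(_ (r0 i) (lift j k)).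
  rewrite !mxE eqxx/= [_ == j]eq_sym (negbTE (neq_lift _ _)).
  rewrite mulr0 addr0 ler_norml => /andP[y1 y2].
  have := fy (lift j k); rewrite drop_coordE lerBlDr.
  rewrite ler_pdivrMr// ler_pdivlMr// => /andP[f1 f2].
  by rewrite ler_pdivrMr// ler_pdivlMr//; apply/andP; split; lra.
have e2 : 0 <= e / 2 by rewrite divr_ge0// ltW.
rewrite exprMn -exprM mulnC exprM.
(* Each of the n+1 projections of A has at most sum_i (2 r_i / e + 2)^n
   points, and (2 r_i / e + 2) (e / 2) = r_i + e. *)
apply: le_trans (_ : (\sum_i (2 * r i / e + 1 + 1) ^+ n) ^+ n.+1
                     * ((e / 2) ^+ n) ^+ n.+1 <= _).
  rewrite ler_wpM2r ?exprn_ge0// (le_trans (loomis_whitney R A n0))//.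
  rewrite -[X in _ ^+ X]card_ord -prodr_const; apply: ler_prod => j _.
  by rewrite ler0n proj.
rewrite -exprMn big_distrl/= le_eqVlt; apply/orP; left; apply/eqP.
congr (_ ^+ _); apply: eq_bigr => i _; rewrite -exprMn; congr (_ ^+ _).
by rewrite -/e; field; rewrite gt_eqF.
Qed.

Lemma HC_le_ball (R : realType) (B : normedModType R) (k : nat) (V : set B)
    (c : B) (r : R) : (0 < k)%N -> 0 <= r ->
  V `<=` closed_ball_ Num.norm c r -> (HC k%:R V <= (r ^+ k)%:E)%E.
Proof.
move=> k0 r0 Vc.
have := @HC_le_finite R B k V unit (fun=> c) (fun=> r) k0 (fun=> r0).
by rewrite sumr_const card_unit; apply=> v /Vc cv; exists tt.
Qed.

Lemma bounded_set_lt (R : realType) (B : normedModType R) (A : set B) :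
  bounded_set A -> exists2 K : R, 0 < K & forall y, A y -> `|y| < K.
Proof.
move=> [M [Mr AM]]; exists (`|M| + 2); first by rewrite ltr_wpDl.
move=> y Ay; apply: (@le_lt_trans _ _ (`|M| + 1)); last first.
  by rewrite ltrD2l ltr1n.
by apply: AM => //; rewrite (le_lt_trans (ler_norm _))// ltrDl.
Qed.

Lemma HC_bounded_fin_num (R : realType) (B : normedModType R) (k : nat)
    (V : set B) : (0 < k)%N -> bounded_set V -> HC k%:R V \is a fin_num.
Proof.
move=> k0 /bounded_set_lt[K K0 VK]; rewrite ge0_fin_numE ?HC_ge0//.
apply: (@le_lt_trans _ _ (K ^+ k)%:E); last exact: ltry.
apply: (@HC_le_ball _ _ _ _ 0) => // [|v /VK /ltW]; first exact: ltW.
by rewrite /closed_ball_/= sub0r normrN.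
Qed.

Lemma HC_isoperimetric_finite (R : realType) (n : nat) (Omega : set 'rV[R]_n.+1)
    (m : nat) (x : 'I_m -> 'rV[R]_n.+1) (r : 'I_m -> R) :
  (0 < n)%N -> open Omega -> bounded_set Omega -> (forall i, 0 <= r i) ->
  boundary Omega `<=` \bigcup_i closed_ball_ Num.norm (x i) (r i) ->
  fine (HC n.+1%:R Omega) ^+ n <= (\sum_i r i ^+ n) ^+ n.+1.
Proof.
move=> n0 oO bO r0 cov; have [K K0 OK] := bounded_set_lt bO.
apply: (@limit_sum_pow_le _ _ _ _ _ (2 * K)) => N.
have [h hO hr] := @HC_le_grid R n N Omega K m x r n0 K0 OK oO r0 cov.
apply: le_trans hr.
have h1 : fine (HC n.+1%:R Omega) <= h.
  by rewrite -lee_fin fineK// HC_bounded_fin_num.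
have h0 : 0 <= fine (HC n.+1%:R Omega) by rewrite fine_ge0// HC_ge0.
by rewrite lerXn2r ?nnegrE// (le_trans h0).
Qed.

Lemma closed_boundary (T : topologicalType) (A : set T) : closed (boundary A).
Proof.
apply: closedI; first exact: closed_closure.
by apply: open_closedC; exact: open_interior.
Qed.

Lemma bounded_set_closure (R : realType) (B : normedModType R) (A : set B) :
  bounded_set A -> bounded_set (closure A).
Proof.
move=> [M [Mr AM]]; exists M; split=> // y My.
have cy : closed [set u : B | `|u| <= y].
  apply: (@closed_comp _ _ (fun u : B => `|u|) [set t | t <= y]).
    by move=> u _; exact: norm_continuous.
  exact: closed_le.
move=> z Az; suff : [set u : B | `|u| <= y] z by [].
by rewrite ((closure_id _).1 cy); apply: closure_subset Az => u Au; exact: AM.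
Qed.

Lemma compact_boundary (R : realType) (n : nat) (A : set 'rV[R]_n) :
  bounded_set A -> compact (boundary A).
Proof.
move=> bA; apply: bounded_closed_compact; last exact: closed_boundary.
have [M [Mr AM]] := bounded_set_closure bA.
by exists M; split=> // y My z [Az _]; exact: AM.
Qed.

(** The inequality for finite coverings bounds the root h^(n/(n+1)), where h is
    the content of Omega, by the cost of any finite covering of the boundary,
    which is compact; so this root is at most the content of the boundary. *)
Theorem HC_isoperimetric (R : realType) (n : nat) (Omega : set 'rV[R]_n.+1) :
  (0 < n)%N -> open Omega -> bounded_set Omega ->
  (HC n.+1%:R Omega <= (HC n%:R (boundary Omega)) `^ (n.+1%:R / n%:R))%E.
Proof.
move=> n0 oO bO.
have n0R : n%:R != 0 :> R by rewrite pnatr_eq0 -lt0n.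
pose h := fine (HC n.+1%:R Omega).
have h0 : 0 <= h by rewrite fine_ge0// HC_ge0.
have hE : HC n.+1%:R Omega = h%:E by rewrite fineK// HC_bounded_fin_num.
have hM : ((h `^ (n%:R / n.+1%:R))%:E <= HC n%:R (boundary Omega))%E.
  apply: le_HC_compact => [|m x r r0 cov]; first exact: compact_boundary.
  have s0 : 0 <= \sum_i r i ^+ n by rewrite sumr_ge0// => i _; rewrite exprn_ge0.
  rewrite -(@ler_pXn2r _ n.+1) ?nnegrE ?powR_ge0//.
  apply: le_trans (HC_isoperimetric_finite n0 oO bO r0 cov).
  rewrite -[leLHS]powR_mulrn ?powR_ge0// -powRrM divfK ?pnatr_eq0//.
  by rewrite powR_mulrn.
have q0 : 0 <= n.+1%:R / n%:R :> R by rewrite divr_ge0.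
have := @gt0_ler_poweR R _ q0 _ _ _ _ hM.
rewrite poweR_EFin -powRrM mulrA divfK ?pnatr_eq0// mulfV// powRr1// -hE.
by apply; rewrite in_itv/= ?leey ?andbT ?HC_ge0// lee_fin powR_ge0.
Qed.

(** * Cubes: equality case, and their boundary as a manifold *)

Lemma HC_mono (R : realType) (B : normedModType R) (m : R) (V W : set B) :
  V `<=` W -> (HC m V <= HC m W)%E.
Proof.
move=> VW; apply/ereal_infP => _ [x [r [r0 Wc ->]]]; apply: ereal_inf_lbound.
by exists x, r; split=> //; exact: subset_trans Wc.
Qed.

Lemma bounded_closed_ball_ (R : realType) (B : normedModType R) (c : B) (r : R) :
  bounded_set (closed_ball_ Num.norm c r).
Proof.
exists (`|c| + r); split; first exact: num_real.
move=> M rM y; rewrite /closed_ball_ /= distrC => cy; rewrite -(subrK c y).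
by rewrite (le_trans (ler_normD _ _))// addrC ltW// (le_lt_trans _ rM)// lerD2l.
Qed.

Lemma ball_sub_closed_ball_ (R : realType) (B : normedModType R) (c : B) (r : R) :
  ball c r `<=` closed_ball_ Num.norm c r.
Proof. by move=> y; rewrite -ball_normE => /ltW. Qed.

Lemma bounded_ball (R : realType) (B : normedModType R) (c : B) (r : R) :
  bounded_set (ball c r).
Proof.
have [M [Mr H]] := bounded_closed_ball_ c r; exists M; split=> // y My z cz.
exact/(H _ My)/ball_sub_closed_ball_.
Qed.

Lemma compact_closed_ball_rV (R : realType) (d : nat) (c : 'rV[R]_d) (r : R) :
  compact (closed_ball_ Num.norm c r).
Proof.
apply: bounded_closed_compact; first exact: bounded_closed_ball_.
exact: closed_closed_ball_.
Qed.

(** From below, the closed cubes of radius rho < r are compact, so that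
    [cube_cover_ge] applies to them; then rho tends to r. *)
Lemma HC_ball (R : realType) (d : nat) (c : 'rV[R]_d) (r : R) : (0 < d)%N ->
  0 < r -> HC d%:R (ball c r) = (r ^+ d)%:E.
Proof.
move=> d0 r0; apply/eqP; rewrite eq_le; apply/andP; split.
  exact: HC_le_ball (ltW r0) (@ball_sub_closed_ball_ _ _ _ _).
have fH : HC d%:R (ball c r) \is a fin_num.
  by apply: HC_bounded_fin_num => //; exact: bounded_ball.
rewrite -(fineK fH) lee_fin.
have cvgr : rho ^+ d @[rho --> r^'-] --> r ^+ d.
  by apply: cvg_at_left_filter; exact: exprn_continuous.
apply: (cvgr_to_le cvgr); near=> rho.
have rho0 : 0 < rho by near: rho; exact: nbhs_left_gt.
have rhor : rho < r by near: rho; exact: nbhs_left_lt.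
rewrite -lee_fin fineK//; apply: (@le_trans _ _ (HC d%:R (closed_ball_ Num.norm c rho))).
  apply: le_HC_compact; first exact: compact_closed_ball_rV.
  by move=> m x s s0; exact: cube_cover_ge.
by apply: HC_mono => y; rewrite -ball_normE/= => /le_lt_trans; apply.
Unshelve. all: by end_near. Qed.

(** The closed ball alone covers the boundary at the cost r^n. *)
Lemma HC_ball_isoperimetric_eq (R : realType) (n : nat) (c : 'rV[R]_n.+1) (r : R) :
  (0 < n)%N -> 0 < r ->
  HC n.+1%:R (ball c r) =
    ((HC n%:R (boundary (ball c r))) `^ (n.+1%:R / n%:R))%E.
Proof.
move=> n0 r0; apply/eqP; rewrite eq_le; apply/andP; split.
  by apply: HC_isoperimetric => //; [exact: ball_open|exact: bounded_ball].
rewrite HC_ball//.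
have n0R : n%:R != 0 :> R by rewrite pnatr_eq0 -lt0n.
have r0' := ltW r0.
have -> : (r ^+ n.+1)%:E = (((r ^+ n)%:E) `^ (n.+1%:R / n%:R))%E.
  rewrite poweR_EFin -!powR_mulrn// -powRrM; congr (_ `^ _)%:E.
  by rewrite mulrC divfK.
apply: gt0_ler_poweR; rewrite ?in_itv/= ?leey ?andbT ?HC_ge0 ?lee_fin ?exprn_ge0//.
apply: (@HC_le_ball _ _ _ _ c) => // y [+ _].
rewrite -/(closed_ball c r) closed_ballE//.
Qed.

Lemma coordinate_cubeE (R : realType) (d : nat) (Omega : set 'rV[R]_d) :
  coordinate_cube Omega -> exists c r, 0 < r /\ Omega = ball c r.
Proof.
move=> [a [s [s0 ->]]]; exists (a + const_mx (s / 2)), (s / 2).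
have s2 : 0 < s / 2 by rewrite divr_gt0.
split=> //; apply/seteqP; split=> x /=.
  move=> H; rewrite -ball_normE/=; apply/rV_norm_ltP => // j.
  by have /andP[] := H j; rewrite !mxE ltr_norml; lra.
rewrite -ball_normE/= => /(rV_norm_ltP _ s2) H j.
by have := H j; rewrite !mxE ltr_norml => /andP[]; lra.
Qed.

(** The ball is the union of the segments issued from its centre. *)
Lemma connected_ball (R : realType) (B : normedModType R) (c : B) (r : R) :
  connected (ball c r).
Proof.
pose seg v := (fun t : R => c + t *: v) @` `[0, 1].
have -> : ball c r = \bigcup_(v in ball 0 r) seg v.
  apply/seteqP; split=> y; rewrite -ball_normE/=.
    move=> cy; exists (y - c); first by rewrite /= sub0r opprB.
    by exists 1; rewrite /= ?in_itv/= ?ler01 ?lexx// scale1r subrKC.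
  move=> [v + [t]]; rewrite /= sub0r normrN in_itv/= => vr /andP[t0 t1] <-.
  rewrite opprD addNKr normrN normrZ ger0_norm// (le_lt_trans _ vr)//.
  by rewrite ler_piMl.
apply: bigcup_connected.
  exists c => v _; exists 0; last by rewrite scale0r addr0.
  by rewrite /= in_itv/= lexx ler01.
move=> v _; apply: connected_continuous_connected; first exact: segment_connected.
apply: continuous_subspaceT => t.
by apply: cvgD; [exact: cvg_cst|apply: cvgZl; exact: cvg_id].
Qed.

Lemma boundary_ball (R : realType) (B : normedModType R) (c : B) (r : R) :
  0 < r -> boundary (ball c r) = [set x | `|c - x| = r].
Proof.
move=> r0; rewrite /boundary -/(closed_ball c r) closed_ballE//.
rewrite (interior_id _).1; last exact: ball_open.
apply/seteqP; split=> x; rewrite -ball_normE/=.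
  move=> [H1 /negP]; rewrite -leNgt => H2; apply/eqP.
  by rewrite eq_le H2 andbT.
by move=> cx; split; rewrite /closed_ball_ /= cx ?ltxx.
Qed.

Lemma cvg_row (R : realType) (T : Type) (F : set_system T) (d : nat)
    (f : 'I_d -> T -> R) (l : 'I_d -> R) : Filter F ->
  (forall j, f j x @[x --> F] --> l j) ->
  (\row_j f j x) @[x --> F] --> (\row_j l j).
Proof.
have rowE (u : 'I_d -> R) : \row_j u j = \sum_j u j *: 'e_j.
  by rewrite [LHS]row_sum_delta; apply: eq_bigr => j _; rewrite mxE.
move=> FF fl; rewrite rowE (_ : (fun x => _) = fun x => \sum_j f j x *: 'e_j).
  by apply: (cvg_big add_continuous) => j _; exact: cvgZl.
by apply/funext => x; rewrite rowE.
Qed.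

(** At a point p of the unit sphere some coordinate p_j is s = 1 or s = -1. On
    the points whose j-th coordinate has the sign s, the chart f is the radial
    projection from 0 onto the hyperplane x_j = s, with that coordinate dropped;
    its inverse g puts the coordinate s back and normalizes. *)
Lemma closed_manifold_sphere (R : realType) (n : nat) :
  closed_manifold n [set x : 'rV[R]_n.+1 | `|0 - x| = 1].
Proof.
split.
  rewrite -boundary_ball//; apply: compact_boundary; exact: bounded_ball.
move=> p /= p1.
have {}p1 : `|p| = 1 by rewrite -p1 sub0r normrN.
have [j pj] : exists j, `|p ord0 j| = 1.
  apply: contrapT => /forallNP H.
  have : `|p| < 1.
    apply/rV_norm_ltP => // j; rewrite lt_neqAle; apply/andP; split.
      by apply/eqP; exact: H.
    by have /rV_norm_leP := lexx `|p|; rewrite p1; apply.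
  by rewrite p1 ltxx.
pose s := Num.sg (p ord0 j).
have s2 : s * s = 1.
  by rewrite /s -expr2 sqr_sg -normr_eq0 pj oner_eq0.
have s0 : s != 0 by apply: contra_eq_neq s2 => ->; rewrite mul0r eq_sym oner_eq0.
have sp : s * p ord0 j = 1 by rewrite /s -normrEsg.
have ccont i (x : 'rV[R]_n.+1) :
    (y : 'rV[R]_n.+1) ord0 i @[y --> x] --> x ord0 i by exact: coord_continuous.
have scont (x : 'rV[R]_n.+1) :
    s * (y : 'rV[R]_n.+1) ord0 j @[y --> x] --> s * x ord0 j.
  exact: (cvgMr (ccont j x)).
pose v (w : 'rV[R]_n) : 'rV[R]_n.+1 := \row_i oapp (w ord0) s (unlift j i).
pose f (x : 'rV[R]_n.+1) : 'rV[R]_n := \row_k (x ord0 (lift j k) / (s * x ord0 j)).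
pose g w := `|v w|^-1 *: v w.
have vj w : v w ord0 j = s by rewrite mxE unlift_none.
have vl w k : v w ord0 (lift j k) = w ord0 k by rewrite mxE liftK.
have v0 w : 0 < `|v w|.
  by rewrite normr_gt0; apply: contra_eq_neq (vj w) => ->; rewrite mxE eq_sym.
exists [set x | 0 < s * x ord0 j], setT, f, g; split.
- apply: (@open_comp _ _ (fun x : 'rV[R]_n.+1 => s * x ord0 j) [set t | 0 < t]);
    last exact: open_gt.
  by move=> x _; exact: scont.
- by rewrite /= sp.
- exact: openT.
split.
- by [].
- move=> _ [w _ <-]; split=> /=.
    by rewrite sub0r normrN normrZ normfV normr_id mulVf// gt_eqF.
  by rewrite mxE vj mulrCA s2 mulr1 invr_gt0.
- move=> x; rewrite inE => -[/= x1 xj].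
  have {}x1 : `|x| = 1 by rewrite -x1 sub0r normrN.
  have vE : v (f x) = (s * x ord0 j)^-1 *: x.
    apply/rowP => i; rewrite [RHS]mxE; case: (unliftP j i) => [k|] ->.
      by rewrite vl mxE mulrC.
    rewrite vj; apply: (mulIf (lt0r_neq0 xj)); rewrite mulrAC mulVf ?gt_eqF//.
    by rewrite mulrA s2.
  rewrite /g vE normrZ x1 mulr1 gtr0_norm ?invr_gt0// invrK scalerA mulfV ?scale1r//.
  by rewrite gt_eqF.
- move=> w _; apply/rowP => k; rewrite mxE [g w]/(_ *: _) !mxE liftK unlift_none/=.
  by rewrite [s * _]mulrCA s2 mulr1 mulrAC mulfV ?mul1r// invr_eq0 gt_eqF.
split.
  apply: continuous_in_subspaceT => x; rewrite inE => -[_ /= xj].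
  apply: (@cvg_row _ _ (nbhs x)) => k; apply: (cvgM (ccont _ x)).
  by apply: (cvgV _ (scont x)); rewrite gt_eqF.
apply: continuous_subspaceT => w.
have cv : v x @[x --> w] --> v w.
  apply: (@cvg_row _ _ (nbhs w)) => i.
  case: unliftP => [k|] _ /=; last exact: cvg_cst.
  exact: coord_continuous.
by apply: (cvgZ (cvgV _ (cvg_norm cv)) cv); rewrite gt_eqF.
Qed.

Lemma bounds_unit_ball (R : realType) (n : nat) :
  bounds n (boundary (ball (0 : 'rV[R]_n.+1) 1)) (ball 0 1).
Proof.
split=> //; last exact: bounded_ball.
- rewrite boundary_ball//; exact: closed_manifold_sphere.
- split; first by exists 0; exact: ballxx.
  + exact: ball_open.
  + exact: connected_ball.
Qed.

(** The cube of radius 1 has content 1, and so has its boundary after taking the power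
    (n+1)/n; this excludes constants smaller than 1. *)
Theorem proposition1p3 (R : realType) (n : nat) (hn : (0 < n)%N) :
  [/\ isop_const 'rV[R]_n.+1 n n%:R = 1%:E,
      forall M Omega : set 'rV[R]_n.+1, bounds n M Omega ->
        (HC n.+1%:R Omega <= (HC n%:R M) `^ (n.+1%:R / n%:R))%E &
      forall Omega : set 'rV[R]_n.+1, coordinate_cube Omega ->
        HC n.+1%:R Omega = ((HC n%:R (boundary Omega)) `^ (n.+1%:R / n%:R))%E].
Proof.
have iso : forall M Omega : set 'rV[R]_n.+1, bounds n M Omega ->
    (HC n.+1%:R Omega <= (HC n%:R M) `^ (n.+1%:R / n%:R))%E.
  by move=> M Omega [_ [_ oO _] bO <-]; exact: HC_isoperimetric.
split=> //; last first.
  by move=> Omega /coordinate_cubeE[c [r [r0 ->]]]; exact: HC_ball_isoperimetric_eq.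
apply/eqP; rewrite eq_le; apply/andP; split.
  apply: ereal_inf_lbound; exists 1 => // M Omega MO.
  by rewrite mul1e natr1; exact: iso.
apply/ereal_infP => _ [k Hk <-].
have := Hk _ _ (bounds_unit_ball R n).
by rewrite natr1 -HC_ball_isoperimetric_eq// HC_ball// expr1n mule1.
Qed.
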